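(* Let $\mathcal I$ be a tensor ideal of $\mathcal T$ satisfying the standing assumption in the context. Then there exist $z_1,z_2\in\mathbb Q(q)$ such that, in $\mathcal T/\mathcal I$, $$\sigma_+-\sigma_-=z_1(1_2-\mathsf U)+z_2(\mathsf H-\mathsf N).$$
   Context: **Monoidal notation.** $\mathbb 1$ is the unit object, morphisms compose right to left ($fg=f\circ g$), $1$ denotes the identity of the object $\mathsf I$, and $1_n$ the identity of $\mathsf I^{\otimes n}$. (String diagrams are read bottom to top; $m$ is a trivalent merge; $\sigma_+$ is the crossing in which the strand from bottom left to top right passes over, $\sigma_-$ the opposite crossing.) **The category $\mathcal T$.** Let $\Bbbk=\mathbb Q(q)$, $\tau=q^{12}$, $\beta=q^{24}$, and let $\delta\in\Bbbk$, $\phi\in\Bbbk^\times$ be arbitrary. $\mathcal T$ is the strict $\Bbbk$-linear monoidal category generated by one object $\mathsf I$ and morphisms $m:\mathsf I^{\otimes2}\to\mathsf I$, $\sigma_+,\sigma_-:\mathsf I^{\otimes 2}\to\mathsf I^{\otimes2}$, $\cup:\mathbb1\to\mathsf I^{\otimes2}$, $\cap:\mathsf I^{\otimes2}\to\mathbb1$, subject to: (R1) $(\cap\otimes1)(1\otimes\cup)=1=(1\otimes\cap)(\cup\otimes1)$; (R2) $(1\otimes m)(\cup\otimes1)=(m\otimes1)(1\otimes\cup)$; this common morphism $\mathsf I\to\mathsf I^{\otimes2}$ is denoted $s$; (R3) $(1\otimes\cap)(\sigma_-\otimes1)=(\cap\otimes1)(1\otimes\sigma_+)$ and $(1\otimes\cap)(\sigma_+\otimes1)=(\cap\otimes1)(1\otimes\sigma_-)$;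 (R4) $\sigma_-\sigma_+=1_2=\sigma_+\sigma_-$; (R5) $(\sigma_+\otimes1)(1\otimes\sigma_+)(\sigma_+\otimes1)=(1\otimes\sigma_+)(\sigma_+\otimes1)(1\otimes\sigma_+)$; (R6) $(1\otimes m)(\sigma_+\otimes1)(1\otimes\sigma_+)=\sigma_+(m\otimes1)$; (R7) $(1\otimes\sigma_+)(\sigma_+\otimes1)(1\otimes s)=(s\otimes1)\sigma_+$; (R8) $\cap\sigma_+=\beta\cap$, $m\sigma_+=\tau m$, $ms=\phi 1$, $\cap\cup=\delta1_{\mathbb1}$, $m\cup=0$. Put $\mathsf U=\cup\cap$, $\mathsf H=(m\otimes1)(1\otimes s)=(1\otimes m)(s\otimes1)$, $\mathsf N=sm$. **Standing assumption.** $\delta\notin\{q^4+q^{-4},\,-q^{16}-q^{-16}\}$, and $\mathcal I$ is a tensor ideal of $\mathcal T$ such that $1_2,\ \mathsf U,\ \mathsf H,\ \mathsf N,\ \sigma_++\sigma_-$ form a $\Bbbk$-basis of $(\mathcal T/\mathcal I)(\mathsf I^{\otimes2},\mathsf I^{\otimes2})$. The same symbols denote morphisms of $\mathcal T$ and their images in $\mathcal T/\mathcal I$. *)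

(* Defs.v *)
From mathcomp Require Import all_boot all_order all_algebra.

Set Implicit Arguments.
Unset Strict Implicit.
Unset Printing Implicit Defensive.

Import GRing.Theory.
Local Open Scope ring_scope.

(* The field Q(q), as the field of fractions of Q[X], with q the class of X. *)
Notation K := {fraction {poly rat}}.
Definition q : K := tofrac ('X : {poly rat}).
Definition tau : K := q ^+ 12.
Definition beta : K := q ^+ 24.

(* The objects of the strict monoidal category generated by one object I are
   the tensor powers of I, so they are represented by natural numbers, n
   standing for the n-th power, with tensor product addn and unit object 0.
   [mor m n] is the type of formal expressions for morphisms from m to n;
   morphisms of T are such expressions modulo [Teq] below. In [crossp] (resp.
   [crossm]) the strand from bottom left to top right passes over (resp. under),
   diagrams being read from bottom to top. *)
Inductive mor : nat -> nat -> Type :=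
| mergem : mor 2 1
| crossp : mor 2 2
| crossm : mor 2 2
| cupm : mor 0 2
| capm : mor 2 0
| idmor n : mor n n
| compm m n p : mor n p -> mor m n -> mor m p
| tensm m n m' n' : mor m n -> mor m' n' -> mor (m + m')%N (n + n')%N
| zerom m n : mor m n
| addm m n : mor m n -> mor m n -> mor m n
| scalem m n : K -> mor m n -> mor m n.

Arguments zerom {m n}.

Declare Scope mor_scope.
Delimit Scope mor_scope with mor.
Bind Scope mor_scope with mor.

Definition subm m n (f g : mor m n) : mor m n := addm f (scalem (-1) g).

Notation "f ∘ g" := (compm f g) (at level 40, left associativity) : mor_scope.
Notation "f ⊗ g" := (tensm f g) (at level 35, right associativity) : mor_scope.
Notation "0" := zerom : mor_scope.
Notation "f + g" := (addm f g) : mor_scope.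
Notation "f - g" := (subm f g) : mor_scope.
Notation "a *: f" := (scalem a f) : mor_scope.

Local Open Scope mor_scope.

(* Strict associativity and unitality of the tensor product hold for objects
   only up to propositional equality in nat, hence this transport. *)
Definition castmor m n m' n' (em : m = m') (en : n = n') (f : mor m n) :
    mor m' n' :=
  ecast x (mor x n') em (ecast y (mor m y) en f).

Definition splitm : mor 1 2 := (idmor 1 ⊗ mergem) ∘ (cupm ⊗ idmor 1).

(* R2 asserts that the other possible definition of [splitm] agrees with it. *)
Inductive Trel (delta phi : K) : forall m n, mor m n -> mor m n -> Prop :=
| R1l : Trel delta phi ((capm ⊗ idmor 1) ∘ (idmor 1 ⊗ cupm)) (idmor 1)
| R1r : Trel delta phi ((idmor 1 ⊗ capm) ∘ (cupm ⊗ idmor 1)) (idmor 1)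
| R2 : Trel delta phi
    ((idmor 1 ⊗ mergem) ∘ (cupm ⊗ idmor 1))
    ((mergem ⊗ idmor 1) ∘ (idmor 1 ⊗ cupm))
| R3l : Trel delta phi
    ((idmor 1 ⊗ capm) ∘ (crossm ⊗ idmor 1))
    ((capm ⊗ idmor 1) ∘ (idmor 1 ⊗ crossp))
| R3r : Trel delta phi
    ((idmor 1 ⊗ capm) ∘ (crossp ⊗ idmor 1))
    ((capm ⊗ idmor 1) ∘ (idmor 1 ⊗ crossm))
| R4l : Trel delta phi (crossm ∘ crossp) (idmor 2)
| R4r : Trel delta phi (crossp ∘ crossm) (idmor 2)
| R5 : Trel delta phi
    ((crossp ⊗ idmor 1) ∘ (idmor 1 ⊗ crossp) ∘ (crossp ⊗ idmor 1))
    ((idmor 1 ⊗ crossp) ∘ (crossp ⊗ idmor 1) ∘ (idmor 1 ⊗ crossp))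
| R6 : Trel delta phi
    ((idmor 1 ⊗ mergem) ∘ (crossp ⊗ idmor 1) ∘ (idmor 1 ⊗ crossp))
    (crossp ∘ (mergem ⊗ idmor 1))
| R7 : Trel delta phi
    ((idmor 1 ⊗ crossp) ∘ (crossp ⊗ idmor 1) ∘ (idmor 1 ⊗ splitm))
    ((splitm ⊗ idmor 1) ∘ crossp)
| R8cap : Trel delta phi (capm ∘ crossp) (beta *: capm)
| R8merge : Trel delta phi (mergem ∘ crossp) (tau *: mergem)
| R8bigon : Trel delta phi (mergem ∘ splitm) (phi *: idmor 1)
| R8loop : Trel delta phi (capm ∘ cupm) (delta *: idmor 0)
| R8lollipop : Trel delta phi (mergem ∘ cupm) 0.

(* Equality of morphisms of T: the smallest congruence that contains the
   defining relations and satisfies the axioms of a strict K-linear monoidal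
   category. *)
Inductive Teq (delta phi : K) : forall m n, mor m n -> mor m n -> Prop :=
| Teq_rel m n (f g : mor m n) : Trel delta phi f g -> Teq delta phi f g
| Teq_refl m n (f : mor m n) : Teq delta phi f f
| Teq_sym m n (f g : mor m n) : Teq delta phi f g -> Teq delta phi g f
| Teq_trans m n (f g h : mor m n) :
    Teq delta phi f g -> Teq delta phi g h -> Teq delta phi f h
| Teq_comp m n p (f f' : mor n p) (g g' : mor m n) :
    Teq delta phi f f' -> Teq delta phi g g' ->
    Teq delta phi (f ∘ g) (f' ∘ g')
| Teq_tens m n m' n' (f f' : mor m n) (g g' : mor m' n') :
    Teq delta phi f f' -> Teq delta phi g g' ->
    Teq delta phi (f ⊗ g) (f' ⊗ g')
| Teq_add m n (f f' g g' : mor m n) :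
    Teq delta phi f f' -> Teq delta phi g g' ->
    Teq delta phi (f + g) (f' + g')
| Teq_scale m n a (f f' : mor m n) :
    Teq delta phi f f' -> Teq delta phi (a *: f) (a *: f')
| Teq_addA m n (f g h : mor m n) : Teq delta phi (f + (g + h)) (f + g + h)
| Teq_addC m n (f g : mor m n) : Teq delta phi (f + g) (g + f)
| Teq_add0 m n (f : mor m n) : Teq delta phi (0 + f) f
| Teq_addN m n (f : mor m n) : Teq delta phi (f - f) 0
| Teq_scale1 m n (f : mor m n) : Teq delta phi (1%R *: f) f
| Teq_scaleA m n a b (f : mor m n) :
    Teq delta phi (a *: (b *: f)) ((a * b)%R *: f)
| Teq_scaleDl m n a b (f : mor m n) :
    Teq delta phi ((a + b)%R *: f) (a *: f + b *: f)
| Teq_scaleDr m n a (f g : mor m n) :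
    Teq delta phi (a *: (f + g)) (a *: f + a *: g)
| Teq_compA m n p r (f : mor p r) (g : mor n p) (h : mor m n) :
    Teq delta phi (f ∘ (g ∘ h)) (f ∘ g ∘ h)
| Teq_comp1l m n (f : mor m n) : Teq delta phi (idmor n ∘ f) f
| Teq_comp1r m n (f : mor m n) : Teq delta phi (f ∘ idmor m) f
| Teq_compDl m n p (f f' : mor n p) (g : mor m n) :
    Teq delta phi ((f + f') ∘ g) (f ∘ g + f' ∘ g)
| Teq_compDr m n p (f : mor n p) (g g' : mor m n) :
    Teq delta phi (f ∘ (g + g')) (f ∘ g + f ∘ g')
| Teq_compZl m n p a (f : mor n p) (g : mor m n) :
    Teq delta phi ((a *: f) ∘ g) (a *: (f ∘ g))
| Teq_compZr m n p a (f : mor n p) (g : mor m n) :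
    Teq delta phi (f ∘ (a *: g)) (a *: (f ∘ g))
| Teq_tensA m n m' n' m'' n'' (f : mor m n) (g : mor m' n') (h : mor m'' n'') :
    Teq delta phi
      (castmor (addnA m m' m'') (addnA n n' n'') (f ⊗ (g ⊗ h)))
      ((f ⊗ g) ⊗ h)
| Teq_tens1l m n (f : mor m n) :
    Teq delta phi (castmor (add0n m) (add0n n) (idmor 0 ⊗ f)) f
| Teq_tens1r m n (f : mor m n) :
    Teq delta phi (castmor (addn0 m) (addn0 n) (f ⊗ idmor 0)) f
| Teq_tens11 m n : Teq delta phi (idmor m ⊗ idmor n) (idmor (m + n)%N)
| Teq_interchange m n p m' n' p' (f : mor n p) (g : mor m n)
    (f' : mor n' p') (g' : mor m' n') :
    Teq delta phi ((f ∘ g) ⊗ (f' ∘ g')) ((f ⊗ f') ∘ (g ⊗ g'))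
| Teq_tensDl m n m' n' (f f' : mor m n) (g : mor m' n') :
    Teq delta phi ((f + f') ⊗ g) (f ⊗ g + f' ⊗ g)
| Teq_tensDr m n m' n' (f : mor m n) (g g' : mor m' n') :
    Teq delta phi (f ⊗ (g + g')) (f ⊗ g + f ⊗ g')
| Teq_tensZl m n m' n' a (f : mor m n) (g : mor m' n') :
    Teq delta phi ((a *: f) ⊗ g) (a *: (f ⊗ g))
| Teq_tensZr m n m' n' a (f : mor m n) (g : mor m' n') :
    Teq delta phi (f ⊗ (a *: g)) (a *: (f ⊗ g)).

Record tensor_ideal (delta phi : K) := TensorIdeal {
  in_ideal :> forall m n, mor m n -> Prop;
  ideal_Teq : forall m n (f g : mor m n),
    Teq delta phi f g -> in_ideal f -> in_ideal g;
  ideal_zero : forall m n, in_ideal (@zerom m n);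
  ideal_add : forall m n (f g : mor m n),
    in_ideal f -> in_ideal g -> in_ideal (f + g);
  ideal_scale : forall m n a (f : mor m n), in_ideal f -> in_ideal (a *: f);
  ideal_compl : forall m n p (f : mor n p) (g : mor m n),
    in_ideal g -> in_ideal (f ∘ g);
  ideal_compr : forall m n p (f : mor n p) (g : mor m n),
    in_ideal f -> in_ideal (f ∘ g);
  ideal_tensl : forall m n m' n' (f : mor m n) (g : mor m' n'),
    in_ideal g -> in_ideal (f ⊗ g);
  ideal_tensr : forall m n m' n' (f : mor m n) (g : mor m' n'),
    in_ideal f -> in_ideal (f ⊗ g)
}.

Section Quotient.
Variables (delta phi : K) (I : tensor_ideal delta phi).

(* Equality of morphisms in T/I. *)
Definition quot_eq m n (f g : mor m n) : Prop := in_ideal I (f - g).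

Definition lin_comb m n d (b : d.-tuple (mor m n)) (c : 'I_d -> K) : mor m n :=
  \big[@addm m n / 0]_(i < d) (c i *: tnth b i).

(* The classes of b form a K-basis of (T/I)(m, n). *)
Definition quot_basis m n d (b : d.-tuple (mor m n)) : Prop :=
  (forall c : 'I_d -> K,
     quot_eq (lin_comb b c) 0 -> forall i, c i = 0%R) /\
  (forall f : mor m n, exists c : 'I_d -> K, quot_eq f (lin_comb b c)).

End Quotient.

Definition Umor : mor 2 2 := cupm ∘ capm.
(* The relations imply Hmor = (idmor 1 ⊗ mergem) ∘ (splitm ⊗ idmor 1) in T. *)
Definition Hmor : mor 2 2 := (mergem ⊗ idmor 1) ∘ (idmor 1 ⊗ splitm).
Definition Nmor : mor 2 2 := splitm ∘ mergem.

(* Main.v *)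
(* Quarter rotation of a two-strand diagram is a linear endomorphism of the
   space of morphisms from I^2 to I^2. It exchanges 1 and U, H and N, and
   sigma_+ and sigma_-, and it preserves every tensor ideal. As
   sigma_+ - sigma_- is sent to its opposite, its coordinates in the basis
   1, U, H, N, sigma_+ + sigma_- are (z1, -z1, z2, -z2, e) with e = -e, so
   that e = 0. *)

From Stdlib Require Import Setoid Morphisms.
Require Import Defs.
From mathcomp Require Import all_boot all_order all_algebra.
Import GRing.Theory.
Local Open Scope ring_scope.

Set Implicit Arguments.
Unset Strict Implicit.
Unset Printing Implicit Defensive.

(** * Setoid rewriting in the category *)

#[local] Instance Teq_Equivalence delta phi m n :
  Equivalence (@Teq delta phi m n).
Proof.
split; [exact: Teq_refl | exact: Teq_sym | exact: Teq_trans].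
Qed.

#[local] Hint Resolve Teq_refl : core.

#[local] Instance compm_Proper delta phi m n p :
  Proper (@Teq delta phi _ _ ==> @Teq delta phi _ _ ==> @Teq delta phi _ _)
    (@compm m n p).
Proof. by move=> f f' ff' g g' gg'; apply: Teq_comp. Qed.

#[local] Instance tensm_Proper delta phi m n m' n' :
  Proper (@Teq delta phi _ _ ==> @Teq delta phi _ _ ==> @Teq delta phi _ _)
    (@tensm m n m' n').
Proof. by move=> f f' ff' g g' gg'; apply: Teq_tens. Qed.

#[local] Instance addm_Proper delta phi m n :
  Proper (@Teq delta phi _ _ ==> @Teq delta phi _ _ ==> @Teq delta phi _ _)
    (@addm m n).
Proof. by move=> f f' ff' g g' gg'; apply: Teq_add. Qed.

#[local] Instance scalem_Proper delta phi m n a :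
  Proper (@Teq delta phi _ _ ==> @Teq delta phi _ _) (@scalem m n a).
Proof. by move=> f f' ff'; apply: Teq_scale. Qed.

(** Counterclockwise quarter turn: the first output of [f] is bent down on the left into the first
    input, and its second input is bent up on the right into the second output. *)
Definition rot (f : mor 2 2) : mor 2 2 :=
  ((capm ⊗ idmor 2) ∘ (idmor 1 ⊗ (f ⊗ idmor 1)) ∘ (idmor 2 ⊗ cupm))%mor.

Section Rotation.
Variables delta phi : K.
Local Notation "f ≡ g" := (Teq delta phi f%mor g%mor) (at level 70).

(** Equality proofs in nat are unique, so the casts may use any proofs [em] and [en], in particular
    [erefl] on closed objects. *)
Lemma tensA_cast m n m' n' m'' n'' (f : mor m n) (g : mor m' n')
    (h : mor m'' n'') (em : (m + (m' + m'') = m + m' + m'')%N)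
    (en : (n + (n' + n'') = n + n' + n'')%N) :
  (f ⊗ g) ⊗ h ≡ castmor em en (f ⊗ (g ⊗ h)).
Proof.
rewrite (eq_irrelevance em (addnA m m' m'')).
rewrite (eq_irrelevance en (addnA n n' n'')).
exact/Teq_sym/Teq_tensA.
Qed.

Lemma tens0r_cast m n (f : mor m n) (em : (m + 0 = m)%N) (en : (n + 0 = n)%N) :
  castmor em en (f ⊗ idmor 0) ≡ f.
Proof.
rewrite (eq_irrelevance em (addn0 m)) (eq_irrelevance en (addn0 n)).
exact: Teq_tens1r.
Qed.

(* When the objects involved are closed, both sides of associativity and
   unitality of the tensor product have convertible types, and the casts along
   [erefl] disappear by computation. *)
Local Notation tensA f g h :=
  (tensA_cast f g h erefl erefl : (f ⊗ g) ⊗ h ≡ f ⊗ (g ⊗ h)).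
Local Notation tens0r f := (tens0r_cast f erefl erefl : f ⊗ idmor 0 ≡ f).

Lemma tens0l m n (f : mor m n) : idmor 0 ⊗ f ≡ f.
Proof.
have := Teq_tens1l delta phi f.
(* [0 + m] computes to [m], so both casts run along loops. *)
by rewrite /castmor !eq_axiomK.
Qed.

Lemma tensA2 m n (f : mor m n) : idmor 1 ⊗ (idmor 1 ⊗ f) ≡ idmor 2 ⊗ f.
Proof.
rewrite -(tensA (idmor 1) (idmor 1) f).
by rewrite Teq_tens11.
Qed.

Lemma compA m n p r (f : mor p r) (g : mor n p) (h : mor m n) :
  f ∘ g ∘ h ≡ f ∘ (g ∘ h).
Proof. exact/Teq_sym/Teq_compA. Qed.

Lemma comp_tens m n p m' n' p' (f : mor n p) (g : mor m n)
    (f' : mor n' p') (g' : mor m' n') :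
  (f ⊗ f') ∘ (g ⊗ g') ≡ (f ∘ g) ⊗ (f' ∘ g').
Proof. exact/Teq_sym/Teq_interchange. Qed.

Lemma tens1_comp k m n p (f : mor n p) (g : mor m n) :
  idmor k ⊗ (f ∘ g) ≡ (idmor k ⊗ f) ∘ (idmor k ⊗ g).
Proof. by rewrite comp_tens Teq_comp1l. Qed.

Lemma comp_tens1 k m n p (f : mor n p) (g : mor m n) :
  (f ∘ g) ⊗ idmor k ≡ (f ⊗ idmor k) ∘ (g ⊗ idmor k).
Proof. by rewrite comp_tens Teq_comp1l. Qed.

(** By interchange both sides equal [f ⊗ g]: diagrams on disjoint strands pass each other
    vertically. *)
Lemma slide m n m' n' (f : mor m n) (g : mor m' n') :
  (f ⊗ idmor n') ∘ (idmor m ⊗ g) ≡ (idmor n ⊗ g) ∘ (f ⊗ idmor m').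
Proof. by rewrite !comp_tens !Teq_comp1l !Teq_comp1r. Qed.

(** * Rotations of the basis diagrams and of the crossings *)

Lemma cap_zigzag : (capm ⊗ idmor 2) ∘ (idmor 1 ⊗ (cupm ⊗ idmor 1)) ≡ idmor 2.
Proof.
rewrite -(Teq_tens11 _ _ 1 1) -(tensA (idmor 1) cupm (idmor 1)).
rewrite -(tensA capm (idmor 1) (idmor 1)).
rewrite -(comp_tens1 1 (capm ⊗ idmor 1) (idmor 1 ⊗ cupm)).
rewrite (Teq_rel (R1l _ _)).
reflexivity.
Qed.

(** The merge inside [splitm] slides above the cap, and the zigzag left below it straightens. *)
Lemma cap_s : (capm ⊗ idmor 1) ∘ (idmor 1 ⊗ splitm) ≡ mergem.
Proof.
rewrite /splitm tens1_comp tensA2 Teq_compA (slide capm mergem) tens0l compA.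
by rewrite cap_zigzag Teq_comp1r.
Qed.

(** The cap of the rotation meets only [g] and its cup only [h], so a composite can be rotated half
    by half. *)
Lemma rot_comp k (g : mor k 2) (h : mor 2 k) :
  rot (g ∘ h) ≡ (((capm ⊗ idmor 1) ∘ (idmor 1 ⊗ g)) ⊗ idmor 1) ∘
    (idmor 1 ⊗ ((h ⊗ idmor 1) ∘ (idmor 1 ⊗ cupm))).
Proof.
rewrite /rot comp_tens1 tens1_comp Teq_compA.
rewrite comp_tens1 -(tensA (idmor 1) g (idmor 1)).
rewrite (tens1_comp _ (h ⊗ idmor 1)) tensA2.
rewrite (tensA capm (idmor 1) (idmor 1)) Teq_tens11 compA.
reflexivity.
Qed.

#[local] Instance rot_Proper :
  Proper (@Teq delta phi _ _ ==> @Teq delta phi _ _) rot.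
Proof. by move=> f g fg; rewrite /rot fg. Qed.

(** The hypothesis has the shape of R3. It trades [f] beside the cap for [g]; then [g] slides below
    the cup, and cap and cup cancel by R1. *)
Lemma rot_cross (f g : mor 2 2) :
  (idmor 1 ⊗ capm) ∘ (g ⊗ idmor 1) ≡ (capm ⊗ idmor 1) ∘ (idmor 1 ⊗ f) ->
  rot f ≡ g.
Proof.
move=> fg; rewrite -(Teq_comp1r _ _ f) rot_comp -fg.
rewrite Teq_tens11 Teq_comp1l tensA2 comp_tens1.
rewrite (tensA (idmor 1) capm (idmor 1)) compA.
rewrite (tensA g (idmor 1) (idmor 1)) Teq_tens11.
rewrite (slide g cupm) Teq_compA -(tensA2 cupm).
rewrite -(tens1_comp 1 (capm ⊗ idmor 1) (idmor 1 ⊗ cupm)).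
rewrite (Teq_rel (R1l _ _)) Teq_tens11 Teq_comp1l.
exact: (tens0r g).
Qed.

Lemma rot_id : rot (idmor 2) ≡ Umor.
Proof.
rewrite /rot Teq_tens11 (Teq_tens11 _ _ 1 3) Teq_comp1r (slide capm cupm).
by rewrite tens0l (tens0r capm).
Qed.

(** Both halves given by [rot_comp] are zigzags. *)
Lemma rot_U : rot Umor ≡ idmor 2.
Proof.
rewrite /Umor rot_comp !(Teq_rel (R1l _ _)) !Teq_tens11.
by rewrite Teq_comp1l.
Qed.

Lemma rot_N : rot Nmor ≡ Hmor.
Proof.
by rewrite /Nmor rot_comp cap_s -(Teq_rel (R2 _ _)).
Qed.

(** Both sides are two adjacent cups with their inner legs merged; R2 reads the merge as a split of
    either leg of a single cup. *)
Lemma s_cup : (splitm ⊗ idmor 1) ∘ cupm ≡ (idmor 1 ⊗ splitm) ∘ cupm.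
Proof.
rewrite /splitm comp_tens1.
rewrite (tensA (idmor 1) mergem (idmor 1)) compA.
rewrite (tensA cupm (idmor 1) (idmor 1)) Teq_tens11.
(* Both sides are two cups side by side, created in either order. *)
have -> : (cupm ⊗ idmor 2) ∘ cupm ≡ (idmor 2 ⊗ cupm) ∘ cupm.
  by rewrite -{2}(tens0l cupm) (slide cupm cupm) (tens0r cupm).
rewrite Teq_compA -(tensA2 cupm).
rewrite -(tens1_comp 1 (mergem ⊗ idmor 1) (idmor 1 ⊗ cupm)).
by rewrite -(Teq_rel (R2 _ _)).
Qed.

(** By [s_cup] the split moves to the rightmost strand, from where it slides to the top. Below it
    remains a merge bent by a cap and a cup, which R2 and [cap_s] turn back into [mergem]. *)
Lemma rot_H : rot Hmor ≡ Nmor.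
Proof.
rewrite /Hmor rot_comp -(tensA (idmor 1) mergem (idmor 1)).
rewrite -(comp_tens1 1 capm (idmor 1 ⊗ mergem)).
rewrite (tensA (idmor 1) splitm (idmor 1)).
rewrite -(tens1_comp 1 (splitm ⊗ idmor 1) cupm) s_cup.
rewrite (tensA (capm ∘ (idmor 1 ⊗ mergem)) (idmor 1) (idmor 1)) Teq_tens11.
rewrite (tensA2 ((idmor 1 ⊗ splitm) ∘ cupm)) tens1_comp.
rewrite -(tensA (idmor 2) (idmor 1) splitm) Teq_tens11 Teq_compA.
rewrite (slide (capm ∘ (idmor 1 ⊗ mergem)) splitm) tens0l.
rewrite (compA splitm) comp_tens1.
rewrite -(tensA2 cupm) (tensA (idmor 1) mergem (idmor 1)).
rewrite (compA (capm ⊗ idmor 1)).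
rewrite -(tens1_comp 1 (mergem ⊗ idmor 1) (idmor 1 ⊗ cupm)).
by rewrite -(Teq_rel (R2 _ _)) cap_s.
Qed.

(** * Linear structure of the hom spaces and linearity of the rotation *)

Lemma addCA m n (f g h : mor m n) : f + (g + h) ≡ g + (f + h).
Proof. by rewrite !Teq_addA (Teq_addC _ _ f). Qed.

Lemma addACA m n (f g h k : mor m n) : (f + g) + (h + k) ≡ (f + h) + (g + k).
Proof. by rewrite -!Teq_addA (addCA g). Qed.

Lemma addf0 m n (f : mor m n) : f + 0 ≡ f.
Proof. by rewrite Teq_addC Teq_add0. Qed.

Lemma scale0f m n (f : mor m n) : 0%R *: f ≡ 0.
Proof.
rewrite -(addrN 1%R) Teq_scaleDl Teq_scale1.
exact: Teq_addN.
Qed.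

Lemma scalef0 m n a : a *: (0 : mor m n) ≡ 0.
Proof. by rewrite -(scale0f 0) Teq_scaleA mulr0. Qed.

Lemma rotD f g : rot (f + g) ≡ rot f + rot g.
Proof. by rewrite /rot Teq_tensDl Teq_tensDr Teq_compDr Teq_compDl. Qed.

Lemma rotZ a f : rot (a *: f) ≡ a *: rot f.
Proof. by rewrite /rot Teq_tensZl Teq_tensZr Teq_compZr Teq_compZl. Qed.

Lemma rot0 : rot 0 ≡ 0.
Proof. by rewrite -{1}(scale0f 0) rotZ scale0f. Qed.

Lemma rot_crossp : rot crossp ≡ crossm.
Proof. exact/rot_cross/Teq_rel/R3l. Qed.

Lemma rot_crossm : rot crossm ≡ crossp.
Proof. exact/rot_cross/Teq_rel/R3r. Qed.

(** The nesting and the final [0] are those of the unfolded iterated sum in [lin_comb], so that the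
    two agree as expressions. *)
Definition std_comb (a b c d e : K) : mor 2 2 :=
  (a *: idmor 2 + (b *: Umor + (c *: Hmor + (d *: Nmor +
    (e *: (crossp + crossm) + 0)))))%mor.

Lemma std_combD a b c d e a' b' c' d' e' :
  std_comb a b c d e + std_comb a' b' c' d' e' ≡
  std_comb (a + a')%R (b + b')%R (c + c')%R (d + d')%R (e + e')%R.
Proof.
rewrite /std_comb !Teq_scaleDl.
do !(rewrite addACA; apply: Teq_add => //).
exact: Teq_add0.
Qed.

Lemma rot_std_comb a b c d e :
  rot (std_comb a b c d e) ≡ std_comb b a d c e.
Proof.
rewrite /std_comb !rotD !rotZ rot0 !rotD rot_id rot_U rot_H rot_N.
rewrite rot_crossp rot_crossm (Teq_addC _ _ crossm).
by rewrite addCA (addCA (c *: Nmor)).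
Qed.

Lemma std_comb_antisym a c :
  std_comb a (- a)%R c (- c)%R 0%R ≡
    a *: (idmor 2 - Umor) + c *: (Hmor - Nmor).
Proof.
rewrite /std_comb /subm scale0f Teq_add0 addf0 !Teq_scaleDr !Teq_scaleA !mulrN1.
exact: Teq_addA.
Qed.

Lemma rot_cross_diff : rot (crossp - crossm) ≡ (-1)%R *: (crossp - crossm).
Proof.
rewrite /subm rotD rotZ rot_crossp rot_crossm Teq_scaleDr Teq_scaleA.
by rewrite mulN1r opprK Teq_scale1 Teq_addC.
Qed.

End Rotation.

(** * Coordinates in the quotient by the ideal *)

Lemma lin_comb_std (x : 'I_5 -> K) :
  lin_comb [tuple idmor 2; Umor; Hmor; Nmor; (crossp + crossm)%mor] x =
  std_comb (x (inord 0)) (x (inord 1)) (x (inord 2)) (x (inord 3))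
    (x (inord 4)).
Proof.
rewrite /lin_comb !big_ord_recl big_ord0 !(tnth_nth zerom) /=.
by do ![congr (addm (scalem (x _) _) _);
  first by apply: val_inj; rewrite /= inordK].
Qed.

#[local] Existing Instance rot_Proper.

(** This excludes characteristic 2, so that [e + e = 0] will force [e = 0]. *)
Lemma fraction_two_neq0 : (1 + 1 : K) != 0.
Proof.
rewrite -tofrac1 -tofracD tofrac_eq0.
by rewrite -polyCD polyC_eq0.
Qed.

(** Rotation only tensors and composes with fixed morphisms, hence it descends to the quotient. *)
Lemma ideal_rot delta phi (I : tensor_ideal delta phi) f :
  in_ideal I f -> in_ideal I (rot f).
Proof.
move=> If; apply/ideal_compr/ideal_compl.
exact (ideal_tensl (idmor 1) (ideal_tensr (idmor 1) If)).
Qed.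

Theorem proposition3p2 (delta phi : K)
  (hphi : phi != 0)
  (hdelta1 : delta != q ^+ 4 + q ^- 4)
  (hdelta2 : delta != - q ^+ 16 - q ^- 16)
  (I : tensor_ideal delta phi)
  (hbasis : quot_basis I
     [tuple idmor 2; Umor; Hmor; Nmor; (crossp + crossm)%mor]) :
  exists z1 z2 : K,
    quot_eq I (crossp - crossm)%mor
      (z1 *: (idmor 2 - Umor) + z2 *: (Hmor - Nmor))%mor.
Proof.
have [free span] := hbasis.
have [x] := span (crossp - crossm)%mor; rewrite lin_comb_std /quot_eq.
set a := x _; set b := x _; set c := x _; set d := x _; set e := x _ => Dx.
(* Linear independence, restated for explicit coefficients. *)
have {}free a' b' c' d' e' : in_ideal I (std_comb a' b' c' d' e') ->
    [/\ a' = 0, b' = 0, c' = 0, d' = 0 & e' = 0]%R.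
  pose y (i : 'I_5) := nth 0 [:: a'; b'; c'; d'; e'] i.
  move=> Iy; have {}free : forall i, y i = 0.
    apply: free; apply: ideal_Teq Iy.
    by rewrite lin_comb_std /y !inordK //= /subm scalef0 addf0.
  have y0 i : (i < 5)%N -> nth 0 [:: a'; b'; c'; d'; e'] i = 0.
    by move=> lti; have := free (inord i); rewrite /y inordK.
  by split; [exact: (y0 0%N) | exact: (y0 1%N) | exact: (y0 2%N) | exact: (y0 3%N)
    | exact: (y0 4%N)].
(* Let D be the difference of the crossings and x its expansion. The ideal contains D - x and its
   rotation -D - rot x, so also minus their sum, x + rot x. *)
have: in_ideal I (std_comb (a + b) (b + a) (c + d) (d + c) (e + e)).
  have := ideal_scale (-1) (ideal_add Dx (ideal_rot Dx)); apply: ideal_Teq.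
  rewrite {2}/subm rotD rotZ rot_std_comb rot_cross_diff /subm.
  have diffN := Teq_addN delta phi (crossp - crossm)%mor.
  rewrite /subm in diffN; rewrite addACA diffN Teq_add0.
  by rewrite -Teq_scaleDr std_combD Teq_scaleA mulN1r opprK Teq_scale1.
case/free => ab0 _ cd0 _ ee0.
have e0 : e = 0.
  apply/eqP; move/eqP: ee0; rewrite -[e]mulr1 -mulrDr mulf_eq0.
  by rewrite (negbTE fraction_two_neq0) orbF mulr1.
(* The witnesses are the coordinates on [idmor 2] and [Hmor]; those on [Umor] and [Nmor] are their
   opposites. *)
exists a, c; apply: ideal_Teq Dx.
rewrite /subm e0 -std_comb_antisym.
by rewrite -(addr0_eq ab0) -(addr0_eq cd0).
Qed.
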